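(* Let $A\in\mathbb{R}^{m\times n}$ and let $r$ be an integer with $1\le r<\min\{m,n\}$. Let $I\subset\{1,\dots,m\}$ and $J\subset\{1,\dots,n\}$ with $\#(I)=\#(J)=r$ be such that $A_{I,J}$ has the maximal volume among all $r\times r$ submatrices of $A$, and assume $A_{I,J}$ is nonsingular. Let $A_r=A_{:,J}A_{I,J}^{-1}A_{I,:}$. Then $$\|A-A_r\|_C\le \frac{(r+1)\,\sigma_{r+1}(A)}{\sqrt{1+\sum_{k=1}^{r}\frac{\sigma_{r+1}^2(A)}{\sigma_k^2(A)}}}.$$
   Context: For row indices $I$ and column indices $J$, $A_{I,:}$ is the submatrix of all rows of $A$ indexed by $I$, $A_{:,J}$ is the submatrix of all columns indexed by $J$, and $A_{I,J}$ is the submatrix on rows $I$ and columns $J$. The volume of a square matrix is the absolute value of its determinant. The Chebyshev norm is $\|A\|_C=\max_{i,j}|a_{ij}|$. $\sigma_1(A)\ge\sigma_2(A)\ge\cdots$ are the singular values of $A$ in decreasing order. The matrix $A_r$ is called the $r$-cross approximation of $A$. *)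

(* Defs.v *)
From HB Require Import structures.
From mathcomp Require Import all_boot all_order all_algebra.
From mathcomp Require Import polyrcf.
From mathcomp Require Import reals matrix_normedtype.

Set Implicit Arguments.
Unset Strict Implicit.
Unset Printing Implicit Defensive.

Import Order.TTheory GRing.Theory Num.Theory.
Local Open Scope ring_scope.

(* The increasing enumeration of an r-element set of indices. *)
Definition idx (m r : nat) (I : {set 'I_m}) (hI : #|I| = r) (i : 'I_r) : 'I_m :=
  enum_val (cast_ord (esym hI) i).

Section Submatrices.
Variables (R : realDomainType) (m n r : nat) (A : 'M[R]_(m, n)).

Definition rows_mx (I : {set 'I_m}) (hI : #|I| = r) : 'M[R]_(r, n) :=
  rowsub (idx hI) A.

Definition cols_mx (J : {set 'I_n}) (hJ : #|J| = r) : 'M[R]_(m, r) :=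
  colsub (idx hJ) A.

Definition sub_mx (I : {set 'I_m}) (J : {set 'I_n})
    (hI : #|I| = r) (hJ : #|J| = r) : 'M[R]_r :=
  mxsub (idx hI) (idx hJ) A.

End Submatrices.

Definition volume (R : realDomainType) (r : nat) (B : 'M[R]_r) : R := `|\det B|.

Definition max_volume (R : realDomainType) (m n r : nat) (A : 'M[R]_(m, n))
    (I : {set 'I_m}) (J : {set 'I_n}) (hI : #|I| = r) (hJ : #|J| = r) : Prop :=
  forall (I' : {set 'I_m}) (J' : {set 'I_n}) (hI' : #|I'| = r) (hJ' : #|J'| = r),
    volume (sub_mx A hI' hJ') <= volume (sub_mx A hI hJ).

Definition cross_approx (R : realFieldType) (m n r : nat) (A : 'M[R]_(m, n))
    (I : {set 'I_m}) (J : {set 'I_n}) (hI : #|I| = r) (hJ : #|J| = r)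
    : 'M[R]_(m, n) :=
  cols_mx A hJ *m invmx (sub_mx A hI hJ) *m rows_mx A hI.

(* The roots of p in R, each repeated according to its multiplicity. *)
Definition roots_mult (R : rcfType) (p : {poly R}) : seq R :=
  flatten [seq nseq (mup x p) x | x <- rootsR p].

(* Square roots of the eigenvalues of A^T A, with multiplicity, in decreasing
   order.  The list has n entries; those beyond the first minn m n are zero. *)
Definition singular_values (R : rcfType) (m n : nat) (A : 'M[R]_(m, n)) : seq R :=
  sort (fun x y => y <= x)
    [seq Num.sqrt x | x <- roots_mult (char_poly (A^T *m A))].

(* The index k starts at 1: sigma 1 A is the largest singular value. *)
Definition sigma (R : rcfType) (m n : nat) (k : nat) (A : 'M[R]_(m, n)) : R :=
  (singular_values A)`_k.-1.

(* mx_norm is the largest absolute value of an entry, see mx_normrE. *)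
Definition cheb_norm (R : realDomainType) (m n : nat) (A : 'M[R]_(m, n)) : R :=
  mx_norm A.

(* Main.v *)
(* Fix an entry e = (A - A_r) i j <> 0, and let B be the (r+1) x (r+1) submatrix
   of A obtained by bordering A_{I,J} with row i and column j.  A Schur complement
   gives \det B = e * \det A_{I,J}.  The entries of B^-1 are r x r minors of A over
   \det B, so by maximality of the volume each is at most 1 / |e|, and the squared
   Frobenius norm of B^-1 is at most (r+1)^2 / e^2.  That norm is also the sum of
   the 1 / sigma_k(B)^2, which by interlacing, sigma_k(B) <= sigma_k(A), is at
   least the sum of the 1 / sigma_k(A)^2 over k <= r+1. *)
Require Import Defs.
From HB Require Import structures.
From mathcomp Require Import all_boot all_order all_fingroup all_algebra.
From mathcomp Require Import polyrcf complex spectral sesquilinear.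
From mathcomp Require Import reals matrix_normedtype.

Set Implicit Arguments.
Unset Strict Implicit.
Unset Printing Implicit Defensive.

Import Order.TTheory GRing.Theory Num.Theory.
Local Open Scope ring_scope.
Local Open Scope sesquilinear_scope.

(** * Characteristic polynomials and their roots *)

Lemma char_poly_conj (K : comUnitRingType) n (P D : 'M[K]_n) :
  P \in unitmx -> char_poly (invmx P *m D *m P) = char_poly D.
Proof.
move=> Pu; rewrite /char_poly /char_poly_mx.
have -> : 'X%:M - map_mx polyC (invmx P *m D *m P) =
  map_mx polyC (invmx P) *m ('X%:M - map_mx polyC D) *m map_mx polyC P.
  rewrite mulmxBr mulmxBl !map_mxM; congr (_ - _).
  by rewrite scalar_mxC -mulmxA -map_mxM mulVmx// map_mx1 mulmx1.
by rewrite !det_mulmx mulrC mulrA -det_mulmx -map_mxM mulmxV// map_mx1 det1 mul1r.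
Qed.

Lemma char_poly_diag (K : comNzRingType) n (d : 'rV[K]_n) :
  char_poly (diag_mx d) = \prod_i ('X - (d 0 i)%:P).
Proof.
rewrite char_poly_trig ?diag_mx_is_trig//.
by apply: eq_bigr => i _; rewrite mxE eqxx.
Qed.

(** The two lists are compared by occurrences: each x appears as often as its multiplicity in the
    product, because [rootsR] lists every root only once. *)
Lemma roots_mult_prod (R : rcfType) (s : seq R) :
  perm_eq (roots_mult (\prod_(x <- s) ('X - x%:P))) s.
Proof.
set p := \prod_(x <- s) _.
have p0 : p != 0 by apply/monic_neq0/monic_prod_XsubC.
have rootsE x : (x \in rootsR p) = (x \in s).
  have := roots_on_rootsR p0 x; rewrite in_itv/= => <-.
  by rewrite root_prod_XsubC.
apply/allP => x _ /=; apply/eqP.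
have -> : count_mem x (roots_mult p) = ((x \in rootsR p) * mup x p)%N.
  have : uniq (rootsR p) by exact: uniq_roots.
  rewrite /roots_mult; elim: (rootsR p) => //= y r IH /andP[yr /IH {}IH].
  rewrite count_cat IH count_nseq/= inE [x == y]eq_sym.
  by case: eqVneq yr => //= -> /negbTE->; rewrite mul0n addn0.
rewrite mu_prod_XsubC rootsE; case: (boolP (x \in s)); rewrite ?mul1n//.
by rewrite mul0n => /count_memPn ->.
Qed.

(** * Ordered lists and eigenvalue counts *)

(** If the k-th entry t of [s1] exceeded that of [s2], at least k+1 entries of [s1] but at most k of
    [s2] would be >= t. Nonnegativity of [s2] makes t positive and covers the default 0 past the end
    of a list. *)
Lemma sorted_ge_nth_le (R : realDomainType) (s1 s2 : seq R) k :
  sorted (fun x y => y <= x) s1 -> sorted (fun x y => y <= x) s2 ->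
  all (>= 0) s2 ->
  (forall t, 0 < t -> (count (>= t) s1 <= count (>= t) s2)%N) ->
  s1`_k <= s2`_k.
Proof.
move=> sort1 sort2 pos2 le_count.
have tr : transitive (fun x y : R => y <= x) by move=> x y z xy yz; apply: le_trans xy.
have nth_ge0 : 0 <= s2`_k.
  by case: (ltnP k (size s2)) => kn; [apply: (all_nthP 0 pos2)|rewrite nth_default].
rewrite leNgt; apply/negP => lt21.
have k1 : (k < size s1)%N.
  by rewrite ltnNge; apply/negP => ?;
     rewrite [s1`_k]nth_default// ltNge nth_ge0 in lt21.
have := le_count _ (le_lt_trans nth_ge0 lt21); apply/negP; rewrite -ltnNge.
apply: (@leq_ltn_trans k).
  rewrite -(cat_take_drop k s2) count_cat.
  rewrite [X in (_ + X)%N](_ : _ = 0%N); last first.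
    apply/eqP; rewrite -leqn0 leqNgt -has_count -all_predC.
    apply/(all_nthP 0) => i; rewrite size_drop ltn_subRL => ki.
    rewrite nth_drop /= -ltNge (le_lt_trans _ lt21)//.
    by apply: (sorted_leq_nth tr) => //; rewrite ?inE ?leq_addr//
       (leq_ltn_trans _ ki)// leq_addr.
  by rewrite addn0 (leq_trans (count_size _ _))// size_take; case: ltnP.
rewrite -[X in count _ X](cat_take_drop k.+1 s1) count_cat.
apply: ltn_addr.
suff : all (>= s1`_k) (take k.+1 s1).
  by rewrite all_count => /eqP ->; rewrite size_takel.
apply/(all_nthP 0) => i; rewrite size_takel// => ik.
rewrite nth_take//=; apply: (sorted_leq_nth tr) => //; rewrite ?inE//.
exact: leq_trans k1.
Qed.

Lemma mulmx_trC_diag (C : numClosedFieldType) n (d z : 'rV[C]_n) :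
  (z *m diag_mx d *m z ^t*) 0 0 = \sum_i d 0 i * `|z 0 i| ^+ 2.
Proof.
rewrite mxE; apply: eq_bigr => i _; rewrite mul_mx_diag !mxE normCK.
by rewrite [_ * d 0 i]mulrC mulrA.
Qed.

(* If more of the e than of the d were at least t, a dimension count would give
   z <> 0 supported where e >= t such that z *m U vanishes where d >= t; the
   two quadratic forms would then compare the wrong way. *)
Lemma card_eigen_ge_le (R : rcfType) n p (d : 'rV[R]_n) (e : 'rV[R]_p)
    (U : 'M[R[i]]_(p, n)) (t : R) :
  U \is unitarymx ->
  (forall z : 'rV_p,
     \sum_j (e 0 j)%:C%C * `|z 0 j| ^+ 2 <=
     \sum_i (d 0 i)%:C%C * `|(z *m U) 0 i| ^+ 2) ->
  (#|[pred j | (t <= e 0 j)%R]| <= #|[pred i | (t <= d 0 i)%R]|)%N.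
Proof.
move=> Uu le_form; rewrite leqNgt; apply/negP.
set K := [pred i | _]; set L := [pred j | _] => ltKL.
pose S : 'M[R[i]]_(#|L|, p) := rowsub enum_val 1%:M.
pose M := S *m colsub (enum_val : 'I_#|K| -> 'I_n) U.
have : kermx M != 0.
  by rewrite -mxrank_eq0 mxrank_ker subn_eq0 -ltnNge (leq_ltn_trans (rank_leq_col _)).
case/rowV0Pn => y /sub_kermxP yM y0.
pose z := y *m S.
have zL j : j \notin L -> z 0 j = 0.
  move=> jL; rewrite mxE big1// => i _; rewrite !mxE.
  case: eqP => [ij|]; rewrite ?mulr0//.
  by rewrite -ij enum_valP in jL.
have zUK i : i \in K -> (z *m U) 0 i = 0.
  move=> iK; have /rowP/(_ (enum_rank_in iK i)) := yM.
  rewrite mulmxA -/z mxE [RHS]mxE => <-; rewrite mxE; apply: eq_bigr => j _.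
  by rewrite [colsub _ _ _ _]mxE enum_rankK_in.
have z0 : z != 0.
  apply: contraNneq y0 => z0; apply/eqP/rowP => k; have /rowP/(_ (enum_val k)) := z0.
  rewrite !mxE (bigD1 k)//= big1 ?addr0; last first.
    by move=> i ik; rewrite !mxE (inj_eq enum_val_inj) (negbTE ik) mulr0.
  by rewrite !mxE eqxx mulr1.
have norm_eq : \sum_i `|(z *m U) 0 i| ^+ 2 = \sum_j `|z 0 j| ^+ 2.
  have E q (w : 'rV[R[i]]_q) : \sum_i `|w 0 i| ^+ 2 = (w *m w ^t*) 0 0.
    by rewrite mxE; apply: eq_bigr => i _; rewrite !mxE normCK.
  by rewrite !E trmx_mul map_mxM mulmxA -[z *m U *m _]mulmxA (unitarymxP Uu) mulmx1.
have : t%:C%C * \sum_j `|z 0 j| ^+ 2 <= \sum_j (e 0 j)%:C%C * `|z 0 j| ^+ 2.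
  rewrite mulr_sumr; apply: ler_sum => i _; case: (boolP (i \in L)) => [iL|/zL ->].
    by rewrite ler_wpM2r ?exprn_ge0// lecR.
  by rewrite normr0 expr0n !mulr0.
move/le_trans/(_ (le_form z)); rewrite -norm_eq.
suff /lt_geF -> : \sum_i (d 0 i)%:C%C * `|(z *m U) 0 i| ^+ 2 <
  t%:C%C * \sum_i `|(z *m U) 0 i| ^+ 2 by [].
have le_term i : (d 0 i)%:C%C * `|(z *m U) 0 i| ^+ 2 <= t%:C%C * `|(z *m U) 0 i| ^+ 2.
  case: (boolP (i \in K)) => [/zUK ->|iK]; first by rewrite normr0 expr0n !mulr0.
  by rewrite ler_wpM2r ?exprn_ge0// lecR ltW// ltNge.
(* Since [U *m U ^t*] is the identity, [z *m U] is nonzero. A nonzero coordinate lies outside [K],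
   where [d] is below t; this makes the inequality strict. *)
have /rV0Pn[i wi] : z *m U != 0.
  apply: contraNneq z0 => w0.
  by rewrite -(mulmx1 z) -(unitarymxP Uu) mulmxA w0 mul0mx.
rewrite mulr_sumr (bigD1 i)//= [ltRHS](bigD1 i)//=; apply: ltr_leD; last exact: ler_sum.
rewrite ltr_pM2r ?exprn_gt0 ?normr_gt0// ltcR ltNge.
by apply: contraNN wi => /zUK ->.
Qed.

(** * Spectral form of the singular values *)

(** Over R[i] the matrix is Hermitian, so it is unitarily diagonalizable with real eigenvalues; [d]
    can thus be taken over R while [P] stays complex. *)
Lemma real_symmetric_spectral (R : rcfType) n (H : 'M[R]_n) :
  H^T = H -> exists (d : 'rV[R]_n) (P : 'M[R[i]]_n), P \is unitarymx /\
    map_mx (real_complex R) H =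
      P ^t* *m diag_mx (map_mx (real_complex R) d) *m P.
Proof.
move=> Hsym; set HC := map_mx _ H.
have herm : HC \is hermsymmx.
  apply/is_hermitianmxP; rewrite expr0 scale1r; apply/matrixP => i j.
  by rewrite /HC -[in LHS]Hsym !mxE; symmetry; apply: conjc_real.
have /mxOverP dR := hermitian_spectral_diag_real herm.
have /orthomx_spectralP HE := hermitian_normalmx herm.
pose d := map_mx (@complex.Re R) (spectral_diag HC).
exists d, (spectralmx HC); split; first exact: spectral_unitarymx.
apply: etrans HE _; rewrite (invmx_unitary (spectral_unitarymx HC)).
congr (_ *m diag_mx _ *m _).
apply/rowP => i; rewrite !mxE; have := dR 0 i.
by case: (spectral_diag HC 0 i) => a b /complex_realP[x] [-> ->].
Qed.

(** Both sides are the Hermitian form of [A^T *m A] at z, once in eigencoordinates and once as a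
    squared norm. *)
Lemma gram_form (R : rcfType) m n (A : 'M[R]_(m, n)) (d : 'rV[R]_n)
    (P : 'M[R[i]]_n) (z : 'rV[R[i]]_n) :
  map_mx (real_complex R) (A^T *m A) =
    P ^t* *m diag_mx (map_mx (real_complex R) d) *m P ->
  \sum_i (d 0 i)%:C%C * `|(z *m P ^t*) 0 i| ^+ 2 =
    \sum_k `|(z *m map_mx (real_complex R) A^T) 0 k| ^+ 2.
Proof.
move=> HE.
transitivity ((z *m map_mx (real_complex R) (A^T *m A) *m z ^t*) 0 0).
  rewrite HE -(mulmxA z) -(mulmxA (P ^t* *m _)).
  have -> : P *m z ^t* = (z *m P ^t*) ^t* by rewrite trmx_mul map_mxM trmxCK.
  rewrite (mulmxA z) (mulmxA z) mulmx_trC_diag.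
  by apply: eq_bigr => i _; rewrite [map_mx _ d _ _]mxE.
rewrite map_mxM mulmxA -mulmxA [LHS]mxE; apply: eq_bigr => k _.
rewrite normCK; congr (_ * _); rewrite !mxE rmorph_sum/=; apply: eq_bigr => i _.
by rewrite rmorphM/= !mxE mulrC; congr (_ * _); symmetry; apply: conjc_real.
Qed.

Lemma singular_values_spectral (R : rcfType) m n (A : 'M[R]_(m, n)) :
  exists (d : 'rV[R]_n) (P : 'M[R[i]]_n), [/\ P \is unitarymx,
    map_mx (real_complex R) (A^T *m A) =
      P ^t* *m diag_mx (map_mx (real_complex R) d) *m P,
    forall i, 0 <= d 0 i &
    perm_eq (singular_values A) [seq Num.sqrt (d 0 i) | i <- enum 'I_n]].
Proof.
have Hsym : (A^T *m A)^T = A^T *m A by rewrite trmx_mul trmxK.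
have [d [P [Pu HE]]] := real_symmetric_spectral Hsym.
exists d, P; split=> //.
  (* With z the i-th row of [P], the eigencoordinates are the i-th basis vector, so the form is
     [d 0 i] itself. *)
  move=> i; rewrite -lecR; have := gram_form (delta_mx 0 i *m P) HE.
  rewrite -(mulmxA _ P) (unitarymxP Pu) mulmx1 (bigD1 i)//= big1 ?addr0.
    rewrite mxE !eqxx normr1 expr1n mulr1 => ->.
    by apply: sumr_ge0 => k _; rewrite exprn_ge0.
  by move=> j ji; rewrite mxE eqxx (negbTE ji) normr0 expr0n mulr0.
rewrite /singular_values perm_sort (map_comp Num.sqrt (fun i => d 0 i)).
apply: perm_map.
have -> : char_poly (A^T *m A) =
    \prod_(x <- [seq d 0 i | i <- enum 'I_n]) ('X - x%:P).
  (* The factorization is checked over R[i], where the diagonalization lives. *)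
  apply: (map_poly_inj (real_complex R)).
  rewrite map_char_poly HE -(invmx_unitary Pu) char_poly_conj ?unitarymx_unit//.
  rewrite char_poly_diag big_map big_enum rmorph_prod/=.
  by apply: eq_bigr => i _; rewrite rmorphB/= map_polyX map_polyC/= mxE.
exact: roots_mult_prod.
Qed.

Lemma ler_sum_inj (K : numDomainType) (I J : finType) (f : I -> J) (F : J -> K) :
  injective f -> (forall j, 0 <= F j) -> \sum_i F (f i) <= \sum_j F j.
Proof.
move=> fI F0.
have -> : \sum_i F (f i) = \sum_(j in [set f i | i in I]) F j.
  by rewrite big_imset//= => i j _ _; apply: fI.
rewrite [leRHS](bigID (mem [set f i | i in I]))/= lerDl.
exact: sumr_ge0.
Qed.

(** Turns the counts in [sorted_ge_nth_le] into the cardinalities in [card_eigen_ge_le], with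
    threshold t squared. *)
Lemma count_singular_values (R : rcfType) m n (A : 'M[R]_(m, n)) (d : 'rV[R]_n) t :
  (forall i, 0 <= d 0 i) -> 0 < t ->
  perm_eq (singular_values A) [seq Num.sqrt (d 0 i) | i <- enum 'I_n] ->
  count (>= t) (singular_values A) = #|[pred i | (t ^+ 2 <= d 0 i)%R]|.
Proof.
move=> d0 t0 /seq.permP ->; rewrite count_map -sum1_count -sum1_card big_enum_cond/=.
apply: eq_bigl => i.
by rewrite inE -[LHS](ler_pXn2r (isT : (0 < 2)%N)) ?nnegrE ?sqrtr_ge0
   ?(ltW t0)// sqr_sqrtr.
Qed.

Lemma size_singular_values (R : rcfType) m n (A : 'M[R]_(m, n)) :
  size (singular_values A) = n.
Proof.
have [d [P [_ _ _ /perm_size ->]]] := singular_values_spectral A.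
by rewrite size_map size_enum_ord.
Qed.

Lemma singular_values_ge0 (R : rcfType) m n (A : 'M[R]_(m, n)) :
  all (>= 0) (singular_values A).
Proof.
by rewrite all_sort all_map; apply/allP => x _ /=; exact: sqrtr_ge0.
Qed.

Lemma sigma_ge0 (R : rcfType) m n k (A : 'M[R]_(m, n)) : 0 <= sigma k A.
Proof.
rewrite /sigma; case: (ltnP k.-1 (size (singular_values A))) => kn.
  by apply: (all_nthP 0 (singular_values_ge0 A)).
by rewrite nth_default.
Qed.

Lemma sorted_singular_values (R : rcfType) m n (A : 'M[R]_(m, n)) :
  sorted (fun x y => y <= x) (singular_values A).
Proof. by apply: sort_sorted => x y; exact: le_total. Qed.

(** * Interlacing for submatrices *)

(** Choosing columns restricts the form of [A^T *m A] to a coordinate subspace, and choosing rows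
    drops nonnegative terms from the sum of squares. So no positive threshold is reached by more
    eigenvalues for the submatrix than for [A]. *)
Lemma sigma_mxsub_le (R : rcfType) m n p q (A : 'M[R]_(m, n))
    (f : 'I_p -> 'I_m) (g : 'I_q -> 'I_n) k :
  injective f -> injective g -> sigma k (mxsub f g A) <= sigma k A.
Proof.
move=> fI gI; set B := mxsub f g A.
have [d [P [Pu AE d0 svA]]] := singular_values_spectral A.
have [e [Q [Qu BE e0 svB]]] := singular_values_spectral B.
apply: sorted_ge_nth_le; rewrite ?sorted_singular_values ?singular_values_ge0// => t t0.
rewrite (@count_singular_values _ _ _ _ d)// (@count_singular_values _ _ _ _ e)//.
pose S : 'M[R[i]]_(q, n) := rowsub g 1%:M.
have Su : S \is unitarymx.
  apply/unitarymxP/matrixP => i j; rewrite !mxE (bigD1 (g i))//= big1 ?addr0.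
    by rewrite !mxE eqxx mul1r (inj_eq gI) eq_sym rmorph_nat.
  by move=> l li; rewrite !mxE eq_sym (negbTE li) mul0r.
(* [Q] leads from the eigencoordinates of [B] to standard ones, [S] extends by zero along [g], and
   [P ^t*] leads to the eigencoordinates of [A]. *)
apply: (card_eigen_ge_le (U := Q *m S *m P ^t*)).
  by apply: mul_unitarymx; [apply: mul_unitarymx | rewrite trmxC_unitary].
move=> z; have := gram_form (z *m Q) BE.
rewrite -[z *m Q *m Q ^t*]mulmxA (unitarymxP Qu) mulmx1 => ->.
rewrite !mulmxA (gram_form _ AE).
have -> : map_mx (real_complex R) B^T = colsub f (S *m map_mx (real_complex R) A^T).
  by rewrite /S mul_rowsub_mx mul1mx; apply/matrixP => i j; rewrite !mxE.
under eq_bigr => l do rewrite mulmx_colsub mxE mulmxA.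
pose w := z *m Q *m S *m map_mx (real_complex R) A^T.
by apply: (@ler_sum_inj _ _ _ f (fun l => `|w 0 l| ^+ 2)) => // j; rewrite exprn_ge0.
Qed.

(** * Inverses and singular values *)

Lemma invmx_eq (K : comUnitRingType) n (X Y : 'M[K]_n) :
  Y *m X = 1%:M -> invmx X = Y.
Proof.
move=> YX; have [_ Xu] := mulmx1_unit YX.
by rewrite -[RHS](mulmxK Xu) YX mul1mx.
Qed.

Lemma spectral_diag_neq0 (R : rcfType) n (H : 'M[R]_n) (d : 'rV[R]_n)
    (P : 'M[R[i]]_n) i :
  H \in unitmx ->
  map_mx (real_complex R) H = P ^t* *m diag_mx (map_mx (real_complex R) d) *m P ->
  d 0 i != 0.
Proof.
move=> Hu HE; have : map_mx (real_complex R) H \in unitmx by rewrite map_unitmx.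
rewrite HE !unitmx_mul => /andP[/andP[_]].
rewrite unitmxE unitfE det_diag => /prodf_neq0/(_ i isT).
by rewrite mxE fmorph_eq0.
Qed.

Lemma sigma_gt0 (R : rcfType) n (B : 'M[R]_n) k :
  B \in unitmx -> (0 < k <= n)%N -> 0 < sigma k B.
Proof.
move=> Bu /andP[k0 kn]; have [e [P [_ BE e0 svB]]] := singular_values_spectral B.
have BBu : B^T *m B \in unitmx by rewrite unitmx_mul unitmx_tr Bu.
have : sigma k B \in singular_values B by rewrite mem_nth// size_singular_values prednK.
rewrite (perm_mem svB) => /mapP[i _ ->].
by rewrite sqrtr_gt0 lt_neqAle e0 eq_sym (spectral_diag_neq0 _ BBu BE).
Qed.

(** Both sides are the trace of the inverse of [B^T *m B]: the sum of its inverse eigenvalues, and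
    the squared Frobenius norm of [invmx B]. *)
Lemma sum_inv_sigma (R : rcfType) n (B : 'M[R]_n) : B \in unitmx ->
  \sum_(1 <= k < n.+1) (sigma k B ^+ 2)^-1 = \sum_i \sum_j invmx B i j ^+ 2.
Proof.
move=> Bu; have [e [P [Pu BE e0 svB]]] := singular_values_spectral B.
transitivity (\sum_(x <- singular_values B) (x ^+ 2)^-1).
  by rewrite big_add1/= [RHS](big_nth 0) size_singular_values.
rewrite (perm_big _ svB)/= big_map big_enum/=.
under eq_bigr => i _ do rewrite sqr_sqrtr//.
have -> : \sum_i \sum_j invmx B i j ^+ 2 = \tr (invmx (B^T *m B)).
  rewrite (@invmx_eq _ _ (B^T *m B) (invmx B *m (invmx B)^T)); last first.
    rewrite trmx_inv mulmxA -(mulmxA (invmx B)) mulVmx ?unitmx_tr// mulmx1.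
    exact: mulVmx.
  rewrite /mxtrace; apply: eq_bigr => i _.
  by rewrite mxE; apply: eq_bigr => j _; rewrite [_^T _ _]mxE expr2.
apply: (fmorph_inj (real_complex R)).
rewrite -[RHS]trace_map_mx map_invmx BE.
have Du i : e 0 i != 0.
  by apply: (spectral_diag_neq0 _ _ BE); rewrite unitmx_mul unitmx_tr Bu.
have Pun := unitarymx_unit Pu; rewrite -(invmx_unitary Pu).
rewrite (@invmx_eq _ _ (_ *m _ *m _)
  (invmx P *m diag_mx (map_mx (real_complex R) (map_mx GRing.inv e)) *m P)); last first.
  rewrite !mulmxA (mulmxK Pun) -(mulmxA (invmx P)) mulmx_diag.
  rewrite (_ : diag_mx _ = 1%:M) ?mulmx1 ?(mulVmx Pun)//.
  rewrite -diag_const_mx; congr diag_mx; apply/rowP => i.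
  by rewrite !mxE -rmorphM/= mulVf ?rmorph1.
rewrite mxtrace_mulC mulmxA (mulmxV Pun) mul1mx mxtrace_diag rmorph_sum/=.
by apply: eq_bigr => i _; rewrite !mxE.
Qed.

(** * Bordered determinants and minors *)

(** Block elimination with a unipotent left factor leaves a block lower triangular matrix whose
    corner is the Schur complement of [D]. *)
Lemma det_bordered (K : comUnitRingType) n (a : 'M[K]_1) (u : 'M_(1, n))
    (v : 'M_(n, 1)) (D : 'M_n) : D \in unitmx ->
  \det (block_mx a u v D) = (a - u *m invmx D *m v) 0 0 * \det D.
Proof.
move=> Du.
have -> : block_mx a u v D = block_mx 1%:M (u *m invmx D) 0 1%:M *m
    block_mx (a - u *m invmx D *m v) 0 v D.
  by rewrite mulmx_block !mul1mx !mul0mx !add0r mulmxKV// subrK.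
by rewrite det_mulmx det_ublock !det1 !mul1r det_lblock
  {1}[a - _]mx11_scalar det_scalar1.
Qed.

Lemma det_mxsub_perm (K : comPzRingType) n (A : 'M[K]_n) (s t : 'S_n) :
  \det (mxsub s t A) = (-1) ^+ s * (-1) ^+ t * \det A.
Proof.
have -> : mxsub s t A = perm_mx s *m (A *m (perm_mx t)^T).
  rewrite tr_perm_mx -row_permE -col_permE.
  by apply/matrixP => i j; rewrite !mxE.
by rewrite !det_mulmx det_tr !det_perm [\det A * _]mulrC mulrA.
Qed.

(** An injection lists its image in some order, hence differs from the increasing enumeration by a
    permutation. *)
Lemma inj_idx_perm m r (f : 'I_r -> 'I_m) : injective f ->
  exists (I : {set 'I_m}) (hI : #|I| = r) (s : 'S_r), f =1 idx hI \o s.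
Proof.
move=> fI; pose I := [set f i | i in 'I_r].
have hI : #|I| = r by rewrite card_imset// card_ord.
have fin i : f i \in I by apply: imset_f.
pose g i := cast_ord hI (enum_rank_in (fin i) (f i)).
have gE i : idx hI (g i) = f i.
  by rewrite /idx /g cast_ordK enum_rankK_in.
have gI : injective g by move=> i j gij; apply: fI; rewrite -!gE gij.
by exists I, hI, (perm gI) => i /=; rewrite permE gE.
Qed.

(** Reordering rows and columns only changes the sign of a minor, so maximality over index sets
    extends to injections. *)
Lemma max_volume_mxsub (R : realDomainType) m n r (A : 'M[R]_(m, n))
    (I : {set 'I_m}) (J : {set 'I_n}) (hI : #|I| = r) (hJ : #|J| = r)
    (f : 'I_r -> 'I_m) (g : 'I_r -> 'I_n) :
  max_volume A hI hJ -> injective f -> injective g ->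
  `|\det (mxsub f g A)| <= volume (sub_mx A hI hJ).
Proof.
move=> maxvol /inj_idx_perm[I' [hI' [s fE]]] /inj_idx_perm[J' [hJ' [t gE]]].
have -> : mxsub f g A = mxsub s t (sub_mx A hI' hJ').
  by apply/matrixP => i j; rewrite !mxE fE gE.
rewrite det_mxsub_perm normrM -exprD normr_sign mul1r.
exact: maxvol.
Qed.

Lemma det_mxsub_neq0_inj (K : comNzRingType) m n p (A : 'M[K]_(m, n))
    (f : 'I_p -> 'I_m) (g : 'I_p -> 'I_n) :
  \det (mxsub f g A) != 0 -> injective f.
Proof.
move=> dn0 i j fij; apply: contraNeq dn0 => ij; apply/eqP.
by apply: (determinant_alternate ij) => k; rewrite !mxE fij.
Qed.

(** The new index comes first and the domain is [1 + r], to match the shape of [block_mx] with a 1 x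
    1 corner. *)
Definition border m r (i : 'I_m) (f : 'I_r -> 'I_m) (k : 'I_(1 + r)) : 'I_m :=
  match split k with inl _ => i | inr l => f l end.

Lemma det_border (R : realFieldType) m n r (A : 'M[R]_(m, n))
    (I : {set 'I_m}) (J : {set 'I_n}) (hI : #|I| = r) (hJ : #|J| = r) i j :
  sub_mx A hI hJ \in unitmx ->
  \det (mxsub (border i (idx hI)) (border j (idx hJ)) A) =
  (A - cross_approx A hI hJ) i j * \det (sub_mx A hI hJ).
Proof.
move=> Du.
have -> : mxsub (border i (idx hI)) (border j (idx hJ)) A =
    block_mx (A i j)%:M (row i (cols_mx A hJ)) (col j (rows_mx A hI)) (sub_mx A hI hJ).
  apply/matrixP => k l; rewrite !mxE /border.
  by case: split => k'; rewrite !mxE; case: split => l'; rewrite !mxE ?ord1 ?eqxx.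
rewrite det_bordered// -row_mul; congr (_ * _).
rewrite !mxE eqxx mulr1n; congr (_ - _).
by apply: eq_bigr => k _; rewrite !mxE.
Qed.

(** By the adjugate formula an entry of the inverse is, up to sign, a minor of size r over the
    determinant, and that minor is again one of [A]. *)
Lemma norm_invmx_mxsub_le (R : realFieldType) m n r (A : 'M[R]_(m, n)) V
    (f : 'I_r.+1 -> 'I_m) (g : 'I_r.+1 -> 'I_n) k l :
  (forall (f' : 'I_r -> 'I_m) (g' : 'I_r -> 'I_n), injective f' -> injective g' ->
     `|\det (mxsub f' g' A)| <= V) ->
  mxsub f g A \in unitmx ->
  `|invmx (mxsub f g A) k l| <= V / `|\det (mxsub f g A)|.
Proof.
move=> maxV Bu; have dn0 : \det (mxsub f g A) != 0 by rewrite -unitfE -unitmxE.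
have fI := det_mxsub_neq0_inj dn0.
have gI : injective g.
  by apply: (@det_mxsub_neq0_inj _ _ _ _ A^T g f); rewrite -trmx_mxsub det_tr.
rewrite /invmx Bu !mxE normrM normfV mulrC ler_pM2r ?invr_gt0 ?normr_gt0//.
rewrite /cofactor normrM normr_sign mul1r.
(* The adjugate transposes: entry (k, l) comes from deleting row l and column k. *)
have -> : row' l (col' k (mxsub f g A)) = mxsub (f \o lift l) (g \o lift k) A.
  by apply/matrixP => a b; rewrite !mxE.
by apply: maxV; apply: inj_comp => //; exact: lift_inj.
Qed.

(** * The error bound *)

Theorem theorem3 (R : realType) (m n r : nat) (A : 'M[R]_(m, n))
    (r_ge1 : (1 <= r)%N) (r_lt : (r < minn m n)%N)
    (I : {set 'I_m}) (J : {set 'I_n}) (hI : #|I| = r) (hJ : #|J| = r)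
    (maxvol : max_volume A hI hJ) (nonsing : sub_mx A hI hJ \in unitmx) :
  cheb_norm (A - cross_approx A hI hJ) <=
    (r.+1%:R * sigma r.+1 A) /
      Num.sqrt (1 + \sum_(1 <= k < r.+1) sigma r.+1 A ^+ 2 / sigma k A ^+ 2).
Proof.
set E := A - _; set D := sub_mx A hI hJ.
(* Covers the initial value 0 of the maximum and the entries where the error vanishes. *)
have rhs_ge0 : 0 <= (r.+1%:R * sigma r.+1 A) /
      Num.sqrt (1 + \sum_(1 <= k < r.+1) sigma r.+1 A ^+ 2 / sigma k A ^+ 2).
  by rewrite !mulr_ge0 ?invr_ge0 ?sqrtr_ge0 ?ler0n ?sigma_ge0.
rewrite /cheb_norm mx_normrE; apply/bigmax_leP; split=> // -[i j] _ /=.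
have [->|Eij] := eqVneq (E i j) 0; first by rewrite normr0.
have dD : \det D != 0 by rewrite -unitfE -unitmxE.
set f := border i (idx hI); set g := border j (idx hJ); pose B := mxsub f g A.
have detB : \det B = E i j * \det D by exact: det_border.
have dB : \det B != 0 by rewrite detB mulf_neq0.
have Bu : B \in unitmx by rewrite unitmxE unitfE.
(* A repeated index would make the determinant vanish, so i lies outside [I], and likewise j outside
   [J]. *)
have fI : injective f := det_mxsub_neq0_inj dB.
have gI : injective g.
  by apply: (@det_mxsub_neq0_inj _ _ _ _ A^T g f); rewrite -trmx_mxsub det_tr.
have invB k l : `|invmx B k l| <= `|E i j|^-1.
  have -> : `|E i j|^-1 = volume D / `|\det B|.
    by rewrite detB normrM invfM mulrC mulfVK// normr_eq0.
  apply: norm_invmx_mxsub_le => // f' g'; exact: max_volume_mxsub.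
have sum_le : \sum_(1 <= k < r.+2) (sigma k A ^+ 2)^-1 <= r.+1%:R ^+ 2 / E i j ^+ 2.
  apply: (@le_trans _ _ (\sum_(1 <= k < r.+2) (sigma k B ^+ 2)^-1)).
    apply: ler_sum_nat => k kr; have sB := sigma_gt0 Bu kr.
    have leBA : sigma k B <= sigma k A := sigma_mxsub_le _ _ fI gI.
    rewrite lef_pV2 ?posrE ?exprn_gt0 ?(lt_le_trans sB)//.
    by rewrite ler_pXn2r ?nnegrE ?sigma_ge0.
  rewrite sum_inv_sigma//.
  apply: (@le_trans _ _ (\sum_(k < r.+1) \sum_(l < r.+1) (E i j ^+ 2)^-1)).
    apply: ler_sum => k _; apply: ler_sum => l _.
    rewrite -exprVn -(real_normK (num_real (invmx B k l)))
      -(real_normK (num_real (E i j)^-1)).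
    by rewrite ler_pXn2r ?nnegrE// normfV.
  by rewrite !sumr_const !card_ord -mulrnA -[leLHS]mulr_natl natrM expr2.
have sA : 0 < sigma r.+1 A.
  apply: lt_le_trans (sigma_mxsub_le _ _ fI gI).
  by rewrite (sigma_gt0 Bu) ?ltnSn.
set T := \sum_(1 <= k < r.+2) _ in sum_le.
(* The summand 1 is the term k = r+1 of [T] after scaling. *)
have -> : 1 + \sum_(1 <= k < r.+1) sigma r.+1 A ^+ 2 / sigma k A ^+ 2 =
    sigma r.+1 A ^+ 2 * T.
  rewrite /T [in RHS]big_nat_recr//= mulrDr mulfV ?expf_neq0 ?gt_eqF//.
  rewrite addrC; congr (_ + _).
  by rewrite mulr_sumr.
have T0 : 0 < T.
  rewrite /T big_nat_recr//= ltr_wpDl ?invr_gt0 ?exprn_gt0//.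
  by apply: sumr_ge0 => k _; rewrite invr_ge0 exprn_ge0 ?sigma_ge0.
(* The factor [sigma r.+1 A] cancels; squaring reduces the claim to [sum_le]. *)
rewrite sqrtrM ?sqr_ge0// sqrtr_sqr (gtr0_norm sA) invfM -mulrA mulVKf ?gt_eqF//.
rewrite ler_pdivlMr ?sqrtr_gt0// -(@ler_pXn2r _ 2) ?nnegrE ?mulr_ge0 ?sqrtr_ge0//.
rewrite exprMn sqr_sqrtr ?(ltW T0)// real_normK ?num_real// mulrC.
by rewrite -ler_pdivlMr// lt_neqAle eq_sym sqrf_eq0 Eij sqr_ge0.
Qed.
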